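(* Let $\gamma>0$ be a given disturbance attenuation level. Consider the linear stochastic system $$x_{k+1}=Ax_k+Bv_k+(Cx_k+Dv_k)w_k,\quad y_k=Kx_k+Lv_k,\quad z_k=Gx_k+Mv_k,\quad k\in\mathcal N,$$ and the filter $$\hat x_{k+1}=A\hat x_k+\hat K(y_k-K\hat x_k),\quad \hat z_k=G\hat x_k,$$ with constant real matrices of compatible dimensions. For symmetric matrices $P_1$, $P_2$ and a matrix $P_K$ put $$\Lambda(P_1,P_2,P_K)=\begin{bmatrix} -P_1&0&0&A'P_1&0&C'P_1&C'P_2&0\\ *&-P_2&0&0&A'P_2-K'P_K'&0&0&G'\\ *&*&-\gamma^2I&B'P_1&B'P_2-L'P_K'&D'P_1&D'P_2&M'\\ *&*&*&-P_1&0&0&0&0\\ *&*&*&*&-P_2&0&0&0\\ *&*&*&*&*&-P_1&0&0\\ *&*&*&*&*&*&-P_2&0\\ *&*&*&*&*&*&*&-I \end{bmatrix}.$$ If there exist symmetric matrices $P_1>0$, $P_2>0$ and a matrix $P_K$ solving the linear matrix inequality $\Lambda(P_1,P_2,P_K)<0$, then the filter with parameter $\hat K=P_2^{-1}P_K$ is a desired $H_\infty$ filter, i.e. the associated augmented system (see context) is both internally stable and externally stable (with level $\gamma$). Moreover, a suboptimal mixed $H_2/H_\infty$ filter can be synthesized by solving the optimization problem of minimizing $\operatorname{trace}(P_1+P_2)$ over $(P_1,P_2,P_K)$ with $P_1>0$, $P_2>0$ subject to the linear matrix inequality $\Lambda(P_1,P_2,P_K)<0$: for a solution $(P_1,P_2,P_K)$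 of this problem, the filter with $\hat K=P_2^{-1}P_K$ is an $H_\infty$ filter, in the sense that the associated augmented system is both internally stable and externally stable with level $\gamma$ (and it is this filter which is called the suboptimal mixed $H_2/H_\infty$ filter).
   Context: $'$ denotes transpose; $*$ denotes the entries determined by symmetry; $>0$ ($<0$) means symmetric positive (negative) definite. $\mathcal N=\{0,1,2,\dots\}$. $\{w_k\}_{k\in\mathcal N}$ is a sequence of independent real-valued random variables on a complete probability space $(\Omega,\mathcal F,\mathcal P)$ with $E[w_k]=0$, $E[w_k^2]=1$; $\mathcal F_0=\{\emptyset,\Omega\}$, $\mathcal F_k=\sigma(w_0,\dots,w_{k-1})$. $l^2_\infty(\Omega,\mathcal F,\{\mathcal F_k\},\mathcal R^{n_v})$ is the space of $\mathcal F_k$-adapted sequences $v=\{v_k\}$ with $\|v\|^2_{l^2_\infty}=E\sum_{k\ge0}\|v_k\|^2<\infty$. Here $x_k,\hat x_k\in\mathcal R^n$, $v_k\in\mathcal R^{n_v}$, $y_k\in\mathcal R^{n_y}$, $z_k\in\mathcal R^{n_z}$. Augmented system: with $\eta_k=\begin{bmatrix} x_k \\ x_k-\hat x_k \end{bmatrix}\in\mathcal R^{2n}$ and $\tilde z_k=z_k-\hat z_k$, $$\eta_{k+1}=\tilde A\eta_k+\tilde Bv_k+(\tilde C\eta_k+\tilde Dv_k)w_k,\qquad \tilde z_k=\tilde G\eta_k+\tilde Mv_k,$$ $$\tilde A=\begin{bmatrix} A & 0 \\ 0 & A-\hat KK \end{bmatrix},\ \tilde B=\begin{bmatrix} B \\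 B-\hat KL \end{bmatrix},\ \tilde C=\begin{bmatrix} C & 0 \\ C & 0 \end{bmatrix},\ \tilde D=\begin{bmatrix} D \\ D \end{bmatrix},\ \tilde G=\begin{bmatrix} 0 & G \end{bmatrix},\ \tilde M=M.$$ Internally stable: with $v\equiv0$, the solution $\eta_k^{0,\eta_0,0}$ of the augmented system starting at time $0$ from deterministic $\eta_0\in\mathcal R^{2n}$ satisfies: for every $\varepsilon>0$, $\lim_{\eta_0\to0}\mathcal P(\sup_{k\ge0}\|\eta_k^{0,\eta_0,0}\|>\varepsilon)=0$; and $\mathcal P(\lim_{k\to\infty}\eta_k^{0,\eta_0,0}=0)=1$ for every $\eta_0$. Externally stable (level $\gamma$): for every nonzero $v\in l^2_\infty(\Omega,\mathcal F,\{\mathcal F_k\},\mathcal R^{n_v})$ and $\eta_0=0$, $\|\tilde z\|^2_{l^2_\infty}\le\gamma^2\|v\|^2_{l^2_\infty}$. *)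

(* Defs.v *)
From HB Require Import structures.
From mathcomp Require Import all_boot all_order all_algebra.
From mathcomp Require Import all_classical all_reals all_analysis.
From mathcomp Require Import ring.

Set Implicit Arguments.
Unset Strict Implicit.
Unset Printing Implicit Defensive.

Import Order.TTheory GRing.Theory Num.Theory.
Import numFieldNormedType.Exports.

Local Open Scope classical_set_scope.
Local Open Scope ring_scope.

Section Matrices.
Variable R : realType.

(* The canonical norm of the library on matrices is the sup norm. *)
Definition enorm m (u : 'cV[R]_m) : R := Num.sqrt (\sum_i u i 0 ^+ 2).

Definition posdef m (X : 'M[R]_m) : Prop :=
  X^T = X /\ forall u : 'cV[R]_m, u != 0 -> 0 < (u^T *m X *m u) 0 0.

Definition negdef m (X : 'M[R]_m) : Prop :=
  X^T = X /\ forall u : 'cV[R]_m, u != 0 -> (u^T *m X *m u) 0 0 < 0.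

Definition row8 m n1 n2 n3 n4 n5 n6 n7 n8
    (X1 : 'M[R]_(m, n1)) (X2 : 'M[R]_(m, n2)) (X3 : 'M[R]_(m, n3))
    (X4 : 'M[R]_(m, n4)) (X5 : 'M[R]_(m, n5)) (X6 : 'M[R]_(m, n6))
    (X7 : 'M[R]_(m, n7)) (X8 : 'M[R]_(m, n8)) :=
  row_mx X1 (row_mx X2 (row_mx X3 (row_mx X4
    (row_mx X5 (row_mx X6 (row_mx X7 X8)))))).

Definition col8 m1 m2 m3 m4 m5 m6 m7 m8 n
    (X1 : 'M[R]_(m1, n)) (X2 : 'M[R]_(m2, n)) (X3 : 'M[R]_(m3, n))
    (X4 : 'M[R]_(m4, n)) (X5 : 'M[R]_(m5, n)) (X6 : 'M[R]_(m6, n))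
    (X7 : 'M[R]_(m7, n)) (X8 : 'M[R]_(m8, n)) :=
  col_mx X1 (col_mx X2 (col_mx X3 (col_mx X4
    (col_mx X5 (col_mx X6 (col_mx X7 X8)))))).

End Matrices.

(*   x_(k+1) = A x_k + B v_k + (C x_k + D v_k) w_k,
         y_k = K x_k + L v_k,      z_k = G x_k + M v_k   *)
Record plant (R : realType) (n nv ny nz : nat) := Plant {
  pA : 'M[R]_(n, n);  pB : 'M[R]_(n, nv);
  pC : 'M[R]_(n, n);  pD : 'M[R]_(n, nv);
  pK : 'M[R]_(ny, n); pL : 'M[R]_(ny, nv);
  pG : 'M[R]_(nz, n); pM : 'M[R]_(nz, nv)
}.

Section Systems.
Variables (R : realType) (T : Type) (n nv ny nz : nat).
Variable S : plant R n nv ny nz.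
Variable w : nat -> T -> R.
Variable v : nat -> T -> 'cV[R]_nv.

Fixpoint plant_state (x0 : 'cV[R]_n) (k : nat) (t : T) : 'cV[R]_n :=
  if k is j.+1 then
    let x := plant_state x0 j t in
    pA S *m x + pB S *m v j t + w j t *: (pC S *m x + pD S *m v j t)
  else x0.

Definition measurement (x0 : 'cV[R]_n) (k : nat) (t : T) : 'cV[R]_ny :=
  pK S *m plant_state x0 k t + pL S *m v k t.

Definition plant_output (x0 : 'cV[R]_n) (k : nat) (t : T) : 'cV[R]_nz :=
  pG S *m plant_state x0 k t + pM S *m v k t.

Variable Khat : 'M[R]_(n, ny).

Fixpoint filter_state (y : nat -> T -> 'cV[R]_ny) (xhat0 : 'cV[R]_n)
    (k : nat) (t : T) : 'cV[R]_n :=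
  if k is j.+1 then
    let xhat := filter_state y xhat0 j t in
    pA S *m xhat + Khat *m (y j t - pK S *m xhat)
  else xhat0.

Definition filter_output (y : nat -> T -> 'cV[R]_ny) (xhat0 : 'cV[R]_n)
    (k : nat) (t : T) : 'cV[R]_nz :=
  pG S *m filter_state y xhat0 k t.

Definition augA : 'M[R]_(n + n) :=
  block_mx (pA S) 0 0 (pA S - Khat *m pK S).
Definition augB : 'M[R]_(n + n, nv) :=
  col_mx (pB S) (pB S - Khat *m pL S).
Definition augC : 'M[R]_(n + n) := block_mx (pC S) 0 (pC S) 0.
Definition augD : 'M[R]_(n + n, nv) := col_mx (pD S) (pD S).
Definition augG : 'M[R]_(nz, n + n) := row_mx 0 (pG S).
Definition augM : 'M[R]_(nz, nv) := pM S.

Fixpoint aug_state (eta0 : 'cV[R]_(n + n)) (k : nat) (t : T)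
    : 'cV[R]_(n + n) :=
  if k is j.+1 then
    let eta := aug_state eta0 j t in
    augA *m eta + augB *m v j t + w j t *: (augC *m eta + augD *m v j t)
  else eta0.

Definition aug_output (eta0 : 'cV[R]_(n + n)) (k : nat) (t : T)
    : 'cV[R]_nz :=
  augG *m aug_state eta0 k t + augM *m v k t.

(* The augmented system is the one satisfied by (x_k, x_k - xhat_k) and
   z_k - zhat_k. *)
Lemma aug_stateE (x0 xhat0 : 'cV[R]_n) k t :
  aug_state (col_mx x0 (x0 - xhat0)) k t =
  col_mx (plant_state x0 k t)
    (plant_state x0 k t - filter_state (measurement x0) xhat0 k t).
Proof.
elim: k => [//|k IH] /=; rewrite IH /augA /augB /augC /augD /measurement.
rewrite !mul_block_col !mul_col_mx !mul0mx !addr0 add0r.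
rewrite !add_col_mx scale_col_mx add_col_mx; congr col_mx.
set x := plant_state _ _ _; set xhat := filter_state _ _ _ _.
rewrite !(mulmxBl, mulmxBr, mulmxDr) -!mulmxA.
rewrite (addrAC _ (w k t *: _)) !scalerDr; congr (_ + _).
apply/matrixP => i j; rewrite !mxE; ring.
Qed.

Lemma aug_outputE (x0 xhat0 : 'cV[R]_n) k t :
  aug_output (col_mx x0 (x0 - xhat0)) k t =
  plant_output x0 k t - filter_output (measurement x0) xhat0 k t.
Proof.
rewrite /aug_output aug_stateE /augG mul_row_col mul0mx add0r mulmxBr.
by rewrite addrAC.
Qed.

End Systems.

Section LMI.
Variables (R : realType) (n nv ny nz : nat).
Variables (S : plant R n nv ny nz) (gamma : R).
Let A := pA S. Let B := pB S. Let C := pC S. Let D := pD S.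
Let K := pK S. Let L := pL S. Let G := pG S. Let M := pM S.

(* The blocks below the diagonal are the transposes of those above it,
   simplified with P1^T = P1 and P2^T = P2 (see [Lambda_sym]). *)
Definition Lambda (P1 P2 : 'M[R]_n) (PK : 'M[R]_(n, ny)) :
    'M[R]_(n + (n + (nv + (n + (n + (n + (n + nz))))))) :=
  col8
  (row8 (- P1) 0 0 (A^T *m P1) 0 (C^T *m P1) (C^T *m P2) 0)
  (row8 0 (- P2) 0 0 (A^T *m P2 - K^T *m PK^T) 0 0 G^T)
  (row8 0 0 (- (gamma ^+ 2)%:M)
     (B^T *m P1) (B^T *m P2 - L^T *m PK^T) (D^T *m P1) (D^T *m P2) M^T)
  (row8 (P1 *m A) 0 (P1 *m B) (- P1) 0 0 0 0)
  (row8 0 (P2 *m A - PK *m K) (P2 *m B - PK *m L) 0 (- P2) 0 0 0)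
  (row8 (P1 *m C) 0 (P1 *m D) 0 0 (- P1) 0 0)
  (row8 (P2 *m C) 0 (P2 *m D) 0 0 0 (- P2) 0)
  (row8 0 G M 0 0 0 0 (- 1%:M)).

Lemma Lambda_sym P1 P2 PK :
  P1^T = P1 -> P2^T = P2 -> (Lambda P1 P2 PK)^T = Lambda P1 P2 PK.
Proof.
move=> P1s P2s; rewrite /Lambda /col8 /row8 !tr_col_mx !tr_row_mx.
rewrite !(trmx0, linearN, linearB) /= !trmx_mul !trmxK !tr_scalar_mx P1s P2s.
have swap m1 m2 n1 n2 (a : 'M[R]_(m1, n1)) (b : 'M[R]_(m2, n1))
    (c : 'M[R]_(m1, n2)) (e : 'M[R]_(m2, n2)) :
  row_mx (col_mx a b) (col_mx c e) = col_mx (row_mx a c) (row_mx b e).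
  by rewrite -block_mxEh block_mxEv.
by rewrite !swap.
Qed.

Definition lmi_feasible (P1 P2 : 'M[R]_n) (PK : 'M[R]_(n, ny)) : Prop :=
  [/\ posdef P1, posdef P2 & negdef (Lambda P1 P2 PK)].

(* Minimization of tr (P1 + P2) over the LMI, up to a tolerance eps.  With
   eps = 0 this is an exact minimizer; since the feasible set is open, the
   infimum is not attained when n > 0, and what solving the problem can
   produce is a feasible point within some eps > 0 of the infimum. *)
Definition mixed_solution (eps : R) (P1 P2 : 'M[R]_n) (PK : 'M[R]_(n, ny))
    : Prop :=
  lmi_feasible P1 P2 PK /\
  forall Q1 Q2 QK, lmi_feasible Q1 Q2 QK ->
    \tr (P1 + P2) <= \tr (Q1 + Q2) + eps.

End LMI.

Section Stochastic.
Variables (R : realType) (d : measure_display) (T : measurableType d).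
Variable Pr : probability T R.

Definition mutually_independent (w : nat -> T -> R) : Prop :=
  forall (J : seq nat) (E : nat -> set R), uniq J ->
    (forall j, j \in J -> measurable (E j)) ->
    Pr (\bigcap_(j in [set` J]) (w j @^-1` E j)) =
    (\prod_(j <- J) Pr (w j @^-1` E j))%E.

(* F_k, generated by w_0, ..., w_(k-1); it is {set0, setT} for k = 0. *)
Definition filtration (w : nat -> T -> R) (k : nat) : set (set T) :=
  g_sigma_preimage (fun i : 'I_k => w i).

(* Borel measurability of a random vector is that of its coordinates. *)
Definition adapted (w : nat -> T -> R) m (v : nat -> T -> 'cV[R]_m) : Prop :=
  forall k (i : 'I_m) (E : set R), measurable E ->
    filtration w k [set t | E (v k t i 0)].

Definition l2_norm_sq m (v : nat -> T -> 'cV[R]_m) : \bar R :=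
  (\int[Pr]_t \sum_(0 <= k <oo) (enorm (v k t) ^+ 2)%:E)%E.

Definition in_l2 (w : nat -> T -> R) m (v : nat -> T -> 'cV[R]_m) : Prop :=
  adapted w v /\ (l2_norm_sq v < +oo)%E.

Variables (n nv ny nz : nat) (S : plant R n nv ny nz).
Variable w : nat -> T -> R.
Variables (gamma : R) (Khat : 'M[R]_(n, ny)).

Definition internally_stable : Prop :=
  let eta := aug_state S w (fun _ _ => 0) Khat in
  (forall eps : R, 0 < eps ->
     Pr [set t | (eps%:E < ereal_sup (range (fun k =>
                             (enorm (eta eta0 k t))%:E)))%E]
       @[eta0 --> (0 : 'cV[R]_(n + n))^'] --> 0%E) /\
  (forall eta0 : 'cV[R]_(n + n),
     Pr [set t | eta eta0 k t @[k --> \oo] --> (0 : 'cV[R]_(n + n))] = 1%E).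

(* An element v of l2 is zero iff its norm is. *)
Definition externally_stable : Prop :=
  forall v : nat -> T -> 'cV[R]_nv, in_l2 w v -> l2_norm_sq v != 0%E ->
    (l2_norm_sq (aug_output S w v Khat 0) <=
     (gamma ^+ 2)%:E * l2_norm_sq v)%E.

Definition Hinf_filter : Prop := internally_stable /\ externally_stable.

End Stochastic.

(* Main.v *)
(* Both stability properties come from the quadratic storage function
   V(eta) = eta' diag(P1, P2) eta. Eliminating the last five block rows of the
   LMI (Schur complement) gives the pointwise dissipation inequality
     V(drift) + V(diffusion) + |z|^2 < V(eta) + gamma^2 |v|^2
   for (eta, v) <> 0. Since w_k has mean 0, variance 1 and is independent of the
   F_k-measurable pair (eta_k, v_k), we have E V(eta_(k+1)) = E V(drift) +
   E V(diffusion), so the inequality telescopes. With eta_0 = 0 this bounds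
   E sum |z_k|^2 by gamma^2 E sum |v_k|^2. With v = 0, strictness gives
   E sum |eta_k|^2 <= c V(eta_0); as the sum dominates sup |eta_k|^2, no maximal
   inequality is needed: Markov's inequality bounds P(sup |eta_k| > eps), and
   the almost sure finiteness of the sum forces eta_k --> 0. *)
Require Import Defs.
From HB Require Import structures.
From mathcomp Require Import all_boot all_order all_algebra.
From mathcomp Require Import all_classical all_reals all_analysis.
From mathcomp Require Import measurable_realfun ring lra.

Set Implicit Arguments.
Unset Strict Implicit.
Unset Printing Implicit Defensive.

Import Order.TTheory GRing.Theory Num.Theory.
Import numFieldNormedType.Exports.
Local Open Scope classical_set_scope.
Local Open Scope ring_scope.

(** * Quadratic forms and the linear matrix inequality *)

Definition bform {R : realType} {m : nat} (X : 'M[R]_m) (u v : 'cV[R]_m) : R :=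
  (u^T *m X *m v) 0 0.

Section QuadraticForms.
Context {R : realType}.
Implicit Types m : nat.

Lemma bformE m (X : 'M[R]_m) (u v : 'cV[R]_m) :
  bform X u v = \sum_j \sum_i u i 0 * X i j * v j 0.
Proof.
rewrite /bform mxE; apply: eq_bigr => j _; rewrite mxE mulr_suml.
by apply: eq_bigr => i _; rewrite mxE.
Qed.

Lemma bformDl m (X : 'M[R]_m) (u u' v : 'cV[R]_m) :
  bform X (u + u') v = bform X u v + bform X u' v.
Proof. by rewrite /bform linearD /= !mulmxDl mxE. Qed.

Lemma bformDr m (X : 'M[R]_m) (u v v' : 'cV[R]_m) :
  bform X u (v + v') = bform X u v + bform X u v'.
Proof. by rewrite /bform mulmxDr mxE. Qed.

Lemma bformZl m (X : 'M[R]_m) (c : R) (u v : 'cV[R]_m) :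
  bform X (c *: u) v = c * bform X u v.
Proof. by rewrite /bform linearZ /= -!scalemxAl mxE. Qed.

Lemma bformZr m (X : 'M[R]_m) (c : R) (u v : 'cV[R]_m) :
  bform X u (c *: v) = c * bform X u v.
Proof. by rewrite /bform -scalemxAr mxE. Qed.

Lemma bform0r m (X : 'M[R]_m) (u : 'cV[R]_m) : bform X u 0 = 0.
Proof. by rewrite /bform mulmx0 mxE. Qed.

Lemma bformC m (X : 'M[R]_m) (u v : 'cV[R]_m) :
  X^T = X -> bform X u v = bform X v u.
Proof.
move=> Xs; rewrite /bform -[in RHS]Xs.
have -> : (u^T *m X *m v) 0 0 = (u^T *m X *m v)^T 0 0 by rewrite [RHS]mxE.
by rewrite !trmx_mul trmxK mulmxA.
Qed.

Lemma bform_combination m (X : 'M[R]_m) (c : R) (u v : 'cV[R]_m) : X^T = X ->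
  bform X (u + c *: v) (u + c *: v) =
  bform X u u + 2 * (bform X u v * c) + bform X v v * c ^+ 2.
Proof.
move=> Xs; rewrite !(bformDl, bformDr, bformZl, bformZr) (bformC v u Xs).
ring.
Qed.

Lemma enorm_ge0 m (u : 'cV[R]_m) : 0 <= enorm u.
Proof. exact: sqrtr_ge0. Qed.

Lemma sqr_enorm m (u : 'cV[R]_m) : enorm u ^+ 2 = \sum_i u i 0 ^+ 2.
Proof. by rewrite sqr_sqrtr// sumr_ge0// => i _; rewrite sqr_ge0. Qed.

Lemma sqr_enorm_bform m (u : 'cV[R]_m) : enorm u ^+ 2 = bform 1%:M u u.
Proof.
rewrite sqr_enorm /bform mulmx1 mxE.
by apply: eq_bigr => i _; rewrite mxE expr2.
Qed.

Lemma sqr_coord_le_enorm m (u : 'cV[R]_m) i : u i 0 ^+ 2 <= enorm u ^+ 2.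
Proof.
rewrite sqr_enorm (bigD1 i) //= lerDl sumr_ge0 // => j _; exact: sqr_ge0.
Qed.

Lemma posdef_ge0 m (X : 'M[R]_m) (u : 'cV[R]_m) : posdef X -> 0 <= bform X u u.
Proof.
move=> [_ Xp]; have [->|/Xp/ltW//] := eqVneq u 0.
by rewrite bform0r.
Qed.

(** A nonzero row of the left kernel of [X], transposed, would be a nonzero vector on which the
    quadratic form vanishes. *)
Lemma posdef_unit m (X : 'M[R]_m) : posdef X -> X \in unitmx.
Proof.
move=> [Xs Xp]; rewrite -row_free_unit -kermx_eq0; apply/eqP/row_matrixP => i.
rewrite row0; apply/eqP; apply: contraT => k_neq0.
have := Xp (row i (kermx X))^T.
rewrite trmx_eq0 k_neq0 trmxK -row_mul mulmx_ker row0 mul0mx mxE ltxx.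
by move=> /(_ isT).
Qed.

(* Cauchy-Schwarz for the inner product X, applied to u and X^-1 e_i, bounds
   the coordinate u_i; this replaces the usual compactness of the sphere. *)
Lemma posdef_enorm_le m (X : 'M[R]_m) : posdef X ->
  exists2 c, 0 < c & forall u, enorm u ^+ 2 <= c * bform X u u.
Proof.
move=> Xpos; have [Xs Xp] := Xpos.
(* [y i] represents the [i]-th coordinate functional in the inner product given by [X]. *)
pose y i : 'cV[R]_m := invmx X *m delta_mx i 0.
have Xy i u : bform X u (y i) = u i 0.
  rewrite /bform /y -mulmxA mulKVmx ?posdef_unit// -colE.
  by rewrite !mxE.
(* The summand 1 keeps the constant positive even when the sum is empty, that is for [m = 0]. *)
exists (1 + \sum_i bform X (y i) (y i)).
  by rewrite ltr_pwDl// sumr_ge0// => i _; apply: posdef_ge0.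
move=> u; have uge0 := posdef_ge0 u Xpos.
rewrite mulrDl mul1r sqr_enorm.
apply: (@le_trans _ _ (\sum_i bform X (y i) (y i) * bform X u u)); last first.
  by rewrite -mulr_suml lerDr.
apply: ler_sum => i _.
have yi0 : y i != 0.
  apply/eqP => y0; have := congr1 (mulmx X) y0.
  rewrite /y mulKVmx ?posdef_unit// mulmx0 => /matrixP/(_ i 0).
  by rewrite !mxE !eqxx => /eqP; rewrite oner_eq0.
have Y0 : 0 < bform X (y i) (y i) by exact: Xp.
(* Subtract from [u] its [X]-orthogonal projection on [y i]; nonnegativity of the form at the
   remainder is [c ^+ 2 <= Y * U]. *)
have := posdef_ge0 (u + (- (u i 0 / bform X (y i) (y i))) *: y i) Xpos.
rewrite bform_combination// Xy.
set Y := bform X (y i) (y i) in Y0 *.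
set U := bform X u u; set c := u i 0.
have -> : U + 2 * (c * - (c / Y)) + Y * (- (c / Y)) ^+ 2 = U - c ^+ 2 / Y.
  by field; rewrite gt_eqF.
by rewrite subr_ge0 ler_pdivrMr// mulrC.
Qed.

Lemma tr_col_mx_mul m1 m2 (a b : 'cV[R]_m1) (a' b' : 'cV[R]_m2) :
  (col_mx a a')^T *m col_mx b b' = a^T *m b + a'^T *m b'.
Proof. by rewrite tr_col_mx mul_row_col. Qed.

Lemma bform_block_diag m1 m2 (X : 'M[R]_m1) (Y : 'M[R]_m2) (a b : 'cV[R]_m1)
    (a' b' : 'cV[R]_m2) :
  bform (block_mx X 0 0 Y) (col_mx a a') (col_mx b b') =
  bform X a b + bform Y a' b'.
Proof.
rewrite /bform -mulmxA mul_block_col !mul0mx addr0 add0r tr_col_mx_mul mxE.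
by rewrite !mulmxA.
Qed.

Lemma posdef_block_diag m1 m2 (X : 'M[R]_m1) (Y : 'M[R]_m2) :
  posdef X -> posdef Y -> posdef (block_mx X 0 0 Y).
Proof.
move=> Xp Yp; split.
  by rewrite tr_block_mx !trmx0; case: Xp => -> _; case: Yp => -> _.
move=> u; rewrite -[u]vsubmxK; move: (usubmx u) (dsubmx u) => a b ab0.
rewrite -/(bform _ _ _) bform_block_diag.
have [a0|a0] := eqVneq a 0; last first.
  by rewrite ltr_pwDl//; [case: Xp => _; apply|apply: posdef_ge0].
rewrite ltr_wpDl//; first exact: posdef_ge0.
case: Yp => _; apply; apply: contra_neq ab0 => ->.
by rewrite a0 col_mx0.
Qed.

Lemma bformBl m (P Q : 'M[R]_m) (u v : 'cV[R]_m) :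
  bform (P - Q) u v = bform P u v - bform Q u v.
Proof. by rewrite /bform mulmxBr mulmxBl !mxE. Qed.

Lemma bform_scale m (c : R) (P : 'M[R]_m) (u v : 'cV[R]_m) :
  bform (c *: P) u v = c * bform P u v.
Proof. by rewrite /bform -scalemxAr -scalemxAl mxE. Qed.

Lemma bform_mulmx m p (P : 'M[R]_p) (A : 'M[R]_(p, m)) (u v : 'cV[R]_m) :
  bform P (A *m u) (A *m v) = bform (A^T *m P *m A) u v.
Proof. by rewrite /bform trmx_mul !mulmxA. Qed.

Lemma posdef_scale m (c : R) (P : 'M[R]_m) :
  0 < c -> posdef P -> posdef (c *: P).
Proof.
move=> c0 [Ps Pp]; split; first by rewrite linearZ /= Ps.
move=> u u0; rewrite -/(bform _ _ _) bform_scale mulr_gt0//.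
exact: Pp.
Qed.

Lemma enorm0 m : enorm (0 : 'cV[R]_m) = 0.
Proof. by rewrite /enorm big1 ?sqrtr0// => i _; rewrite mxE expr0n. Qed.

Lemma continuous_bform m (P : 'M[R]_m) : continuous (fun u => bform P u u).
Proof.
have -> : (fun u => bform P u u) =
    (fun u : 'cV[R]_m => \sum_j \sum_i u i 0 * P i j * u j 0).
  by apply/funext => u; rewrite bformE.
apply: continuous_big => [|j _]; first exact: add_continuous.
apply: continuous_big => [|i _ u]; first exact: add_continuous.
apply: (@continuousM _ _ (fun u : 'cV[R]_m => u i 0 * P i j)
  (fun u : 'cV[R]_m => u j 0)); last exact: coord_continuous.
apply: (@continuousM _ _ (fun u : 'cV[R]_m => u i 0) (fun=> P i j)).
  exact: coord_continuous.
exact: cst_continuous.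
Qed.

(** The topology on matrices comes from the sup norm, and every coordinate is bounded by the
    Euclidean norm. *)
Lemma sqr_enorm_cvg0 m (u : nat -> 'cV[R]_m) :
  enorm (u k) ^+ 2 @[k --> \oo] --> 0 -> u k @[k --> \oo] --> (0 : 'cV[R]_m).
Proof.
move=> u0; apply/cvg_ballP => e e0.
have e20 : 0 < e ^+ 2 by rewrite exprn_gt0.
have /cvgrPdist_lt/(_ _ e20) := u0.
apply: filterS => k; rewrite sub0r normrN => uk.
split => // i j; rewrite ord1 /ball /= mxE sub0r normrN.
rewrite -(@ltr_pXn2r _ 2) ?nnegrE ?normr_ge0 ?(ltW e0)//.
rewrite real_normK ?num_real//.
apply: le_lt_trans uk; rewrite ger0_norm ?sqr_ge0//.
exact: sqr_coord_le_enorm.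
Qed.

End QuadraticForms.

(** * Schur complement of the LMI and the dissipation inequality *)

Section LMI.
Context {R : realType} {n nv ny nz : nat}.
Variables (S : plant R n nv ny nz) (gamma : R).

Lemma mul_row8_col8 m p n1 n2 n3 n4 n5 n6 n7 n8
    (X1 : 'M[R]_(m, n1)) (X2 : 'M[R]_(m, n2)) (X3 : 'M[R]_(m, n3))
    (X4 : 'M[R]_(m, n4)) (X5 : 'M[R]_(m, n5)) (X6 : 'M[R]_(m, n6))
    (X7 : 'M[R]_(m, n7)) (X8 : 'M[R]_(m, n8))
    (u1 : 'M[R]_(n1, p)) (u2 : 'M[R]_(n2, p)) (u3 : 'M[R]_(n3, p))
    (u4 : 'M[R]_(n4, p)) (u5 : 'M[R]_(n5, p)) (u6 : 'M[R]_(n6, p))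
    (u7 : 'M[R]_(n7, p)) (u8 : 'M[R]_(n8, p)) :
  row8 X1 X2 X3 X4 X5 X6 X7 X8 *m col8 u1 u2 u3 u4 u5 u6 u7 u8 =
  X1 *m u1 + (X2 *m u2 + (X3 *m u3 + (X4 *m u4 +
    (X5 *m u5 + (X6 *m u6 + (X7 *m u7 + X8 *m u8)))))).
Proof. by rewrite /row8 /col8 !mul_row_col. Qed.

Lemma mul_col8 p q n1 n2 n3 n4 n5 n6 n7 n8
    (X1 : 'M[R]_(n1, p)) (X2 : 'M[R]_(n2, p)) (X3 : 'M[R]_(n3, p))
    (X4 : 'M[R]_(n4, p)) (X5 : 'M[R]_(n5, p)) (X6 : 'M[R]_(n6, p))
    (X7 : 'M[R]_(n7, p)) (X8 : 'M[R]_(n8, p)) (Y : 'M[R]_(p, q)) :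
  col8 X1 X2 X3 X4 X5 X6 X7 X8 *m Y =
  col8 (X1 *m Y) (X2 *m Y) (X3 *m Y) (X4 *m Y)
    (X5 *m Y) (X6 *m Y) (X7 *m Y) (X8 *m Y).
Proof. by rewrite /col8 !mul_col_mx. Qed.

Lemma tr_col8 p n1 n2 n3 n4 n5 n6 n7 n8
    (X1 : 'M[R]_(n1, p)) (X2 : 'M[R]_(n2, p)) (X3 : 'M[R]_(n3, p))
    (X4 : 'M[R]_(n4, p)) (X5 : 'M[R]_(n5, p)) (X6 : 'M[R]_(n6, p))
    (X7 : 'M[R]_(n7, p)) (X8 : 'M[R]_(n8, p)) :
  (col8 X1 X2 X3 X4 X5 X6 X7 X8)^T =
  row8 X1^T X2^T X3^T X4^T X5^T X6^T X7^T X8^T.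
Proof. by rewrite /col8 /row8 !tr_col_mx. Qed.

Lemma tr_mulmxD m p q (A : 'M[R]_(m, p)) (B : 'M[R]_(m, q)) (x : 'cV[R]_p)
    (v : 'cV[R]_q) :
  (A *m x + B *m v)^T = x^T *m A^T + v^T *m B^T.
Proof. by rewrite linearD /= !trmx_mul. Qed.

(* The last five entries of the test vector are chosen so that they annihilate
   the last five block rows of Lambda: this is the Schur complement. *)
Lemma lmi_quadratic_form (P1 P2 : 'M[R]_n) (PK : 'M[R]_(n, ny))
    (x1 x2 : 'cV[R]_n) (v : 'cV[R]_nv) :
  let Khat := invmx P2 *m PK in
  let a := pA S *m x1 + pB S *m v in
  let b := (pA S - Khat *m pK S) *m x2 + (pB S - Khat *m pL S) *m v in
  let c := pC S *m x1 + pD S *m v in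
  let e := pG S *m x2 + pM S *m v in
  let u := col8 x1 x2 v a b c c e in
  posdef P1 -> posdef P2 ->
  bform (Lambda S gamma P1 P2 PK) u u =
  bform P1 a a + bform P2 b b + bform P1 c c + bform P2 c c + bform 1%:M e e
  - bform P1 x1 x1 - bform P2 x2 x2 - gamma ^+ 2 * bform 1%:M v v.
Proof.
move=> Khat a b c e u P1p P2p.
have [P1s _] := P1p; have [P2s _] := P2p.
(* The change of variable that makes the inequality linear: the gain occurs in it only through
   [P2 *m Khat], renamed [PK]. *)
have P2Khat : P2 *m Khat = PK by rewrite /Khat mulKVmx ?posdef_unit.
clearbody Khat.
have P2b : (P2 *m pA S - PK *m pK S) *m x2 + (P2 *m pB S - PK *m pL S) *m v
    = P2 *m b.
  by rewrite /b mulmxDr !mulmxA !mulmxBr !mulmxA P2Khat.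
rewrite /bform -mulmxA /Lambda /u mul_col8 !mul_row8_col8 tr_col8 mul_row8_col8.
rewrite !(mul0mx, addr0, add0r) !mulNmx mul1mx.
have -> : P1 *m pA S *m x1 + (P1 *m pB S *m v - P1 *m a) = 0.
  by rewrite /a mulmxDr !mulmxA addrA subrr.
have -> : (P2 *m pA S - PK *m pK S) *m x2 +
    ((P2 *m pB S - PK *m pL S) *m v - P2 *m b) = 0 by rewrite addrA P2b subrr.
have -> : P1 *m pC S *m x1 + (P1 *m pD S *m v - P1 *m c) = 0.
  by rewrite /c mulmxDr !mulmxA addrA subrr.
have -> : P2 *m pC S *m x1 + (P2 *m pD S *m v - P2 *m c) = 0.
  by rewrite /c mulmxDr !mulmxA addrA subrr.
have -> : pG S *m x2 + (pM S *m v - e) = 0 by rewrite addrA subrr.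
rewrite !(mulmx0, addr0).
(* In each square only the left factor is expanded, which reproduces the cross terms left by the
   first three block rows. *)
have aE : a^T *m P1 *m a =
    x1^T *m (pA S)^T *m P1 *m a + v^T *m (pB S)^T *m P1 *m a.
  by rewrite {1}/a tr_mulmxD !mulmxDl.
have cE Q : c^T *m Q *m c =
    x1^T *m (pC S)^T *m Q *m c + v^T *m (pD S)^T *m Q *m c.
  by rewrite {1}/c tr_mulmxD !mulmxDl.
have eE : e^T *m 1%:M *m e = x2^T *m (pG S)^T *m e + v^T *m (pM S)^T *m e.
  by rewrite mulmx1 {1}/e tr_mulmxD !mulmxDl.
have bE : b^T *m P2 *m b =
    x2^T *m ((pA S)^T *m P2 - (pK S)^T *m PK^T) *m b +
    v^T *m ((pB S)^T *m P2 - (pL S)^T *m PK^T) *m b.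
  have -> : b^T *m P2 = (P2 *m b)^T by rewrite trmx_mul P2s.
  rewrite -P2b tr_mulmxD.
  have trB m (X : 'M[R]_(n, m)) (Z : 'M[R]_(ny, m)) :
      (P2 *m X - PK *m Z)^T = X^T *m P2 - Z^T *m PK^T.
    by rewrite linearB /= !trmx_mul P2s.
  rewrite !trB.
  by rewrite -!mulmxDl.
(* With [a], [b], [c], [e] opaque, what remains is an identity between sums of scalar atoms. *)
clear u P2b; clearbody a b c e.
rewrite aE bE !cE eE mulmx1 !mulmxDr !mulmxN mul_scalar_mx -!scalemxAr !mulmxA.
rewrite !mulmxBr !mulmxA.
have mxD (X Y : 'M[R]_1) : (X + Y) 0 0 = X 0 0 + Y 0 0 by rewrite mxE.
have mxN (X : 'M[R]_1) : (- X) 0 0 = - X 0 0 by rewrite mxE.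
have mxZ (r : R) (X : 'M[R]_1) : (r *: X) 0 0 = r * X 0 0 by rewrite mxE.
rewrite !(mxD, mxN, mxZ).
ring.
Qed.

Lemma lmi_dissipation (P1 P2 : 'M[R]_n) (PK : 'M[R]_(n, ny))
    (eta : 'cV[R]_(n + n)) (v : 'cV[R]_nv) :
  let Khat := invmx P2 *m PK in
  let P := block_mx P1 0 0 P2 in
  let drift := augA S Khat *m eta + augB S Khat *m v in
  let diffusion := augC S *m eta + augD S *m v in
  let z := augG S *m eta + augM S *m v in
  lmi_feasible S gamma P1 P2 PK -> col_mx eta v != 0 ->
  bform P drift drift + bform P diffusion diffusion + enorm z ^+ 2 <
  bform P eta eta + gamma ^+ 2 * enorm v ^+ 2.
Proof.
move=> Khat P drift diffusion z [P1p P2p [_ Ln]] etav0.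
rewrite !sqr_enorm_bform /drift /diffusion /z /P.
rewrite -[eta]vsubmxK in etav0 *.
move: (usubmx eta) (dsubmx eta) etav0 => x1 x2 etav0.
rewrite /augA /augB /augC /augD /augG /augM !mul_block_col !mul_col_mx.
rewrite mul_row_col !(mul0mx, addr0, add0r) !add_col_mx !bform_block_diag.
pose a := pA S *m x1 + pB S *m v.
pose b := (pA S - Khat *m pK S) *m x2 + (pB S - Khat *m pL S) *m v.
(* Both halves of the diffusion equal [c], weighted once by [P1] and once by [P2]; hence its two
   occurrences in the test vector. *)
pose c := pC S *m x1 + pD S *m v.
pose e := pG S *m x2 + pM S *m v.
have := Ln (col8 x1 x2 v a b c c e).
rewrite -/(bform _ _ _) lmi_quadratic_form// -/a -/b -/c -/e.
(* The first three blocks of the test vector are [x1], [x2] and [v], so it can vanish only if [eta]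
   and [v] do. *)
have /[swap] /[apply] : col8 x1 x2 v a b c c e != 0.
  apply: contra_neq etav0.
  rewrite /col8 -[0]vsubmxK => /eq_col_mx[->].
  rewrite -[dsubmx 0]vsubmxK => /eq_col_mx[->].
  rewrite -[dsubmx (dsubmx 0)]vsubmxK => /eq_col_mx[-> _].
  by rewrite !linear0 !col_mx0.
by rewrite -/Khat; lra.
Qed.

End LMI.

(** * Consequences of a feasible LMI: weak dissipation and a Lyapunov function *)

Section Lyapunov.
Context {R : realType} {n nv ny nz : nat}.
Variables (S : plant R n nv ny nz) (gamma : R).
Variables (P1 P2 : 'M[R]_n) (PK : 'M[R]_(n, ny)).
Hypothesis lmi : lmi_feasible S gamma P1 P2 PK.
Let Khat := invmx P2 *m PK.
Let P := block_mx P1 0 0 P2.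

(** The strict inequality extends to the origin, where both sides are 0. *)
Lemma lmi_dissipation_le (eta : 'cV[R]_(n + n)) (v : 'cV[R]_nv) :
  bform P (augA S Khat *m eta + augB S Khat *m v)
    (augA S Khat *m eta + augB S Khat *m v) +
  bform P (augC S *m eta + augD S *m v) (augC S *m eta + augD S *m v) +
  enorm (augG S *m eta + augM S *m v) ^+ 2 <=
  bform P eta eta + gamma ^+ 2 * enorm v ^+ 2.
Proof.
have [etav0|etav0] := eqVneq (col_mx eta v) 0; last first.
  exact/ltW/lmi_dissipation.
move/eqP: etav0; rewrite col_mx_eq0 => /andP[/eqP -> /eqP ->].
by rewrite !mulmx0 !addr0 !bform0r !enorm0 expr0n mulr0 !addr0.
Qed.

(** For zero input the energy lost in one step is a positive definite form [N], since the output
    energy can only help. By [posdef_enorm_le] a multiple [c] of [N] dominates the squared norm, and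
    scaling [P] by [c] absorbs the constant. *)
Lemma lmi_lyapunov : exists2 Q : 'M[R]_(n + n), posdef Q &
  forall u, bform Q (augA S Khat *m u) (augA S Khat *m u) +
    bform Q (augC S *m u) (augC S *m u) + enorm u ^+ 2 <= bform Q u u.
Proof.
have Ppos : posdef P by case: lmi => *; exact: posdef_block_diag.
have Ps : P^T = P by case: Ppos.
pose N := P - (augA S Khat)^T *m P *m augA S Khat - (augC S)^T *m P *m augC S.
have NE u : bform N u u = bform P u u -
    bform P (augA S Khat *m u) (augA S Khat *m u) -
    bform P (augC S *m u) (augC S *m u).
  by rewrite !bformBl !bform_mulmx.
have Npos : posdef N.
  split; first by rewrite !linearB /= !trmx_mul !trmxK Ps !mulmxA.
  move=> u u0; rewrite -/(bform _ _ _) NE.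
  have uv0 : col_mx u (0 : 'cV[R]_nv) != 0 by rewrite col_mx_eq0 negb_and u0.
  have := lmi_dissipation (eta := u) (v := 0) lmi.
  rewrite !mulmx0 !addr0 enorm0 expr0n mulr0 addr0 => /(_ uv0).
  have := sqr_ge0 (enorm (augG S *m u)); rewrite -/Khat -/P; lra.
have [c c0 Nc] := posdef_enorm_le Npos.
exists (c *: P); first exact: posdef_scale.
by move=> u; rewrite !bform_scale; have := Nc u; rewrite NE; lra.
Qed.

End Lyapunov.

(** * Independence of the noise and the past *)

Section ProductRule.
Context {R : realType} {d : measure_display} {T : measurableType d}.
Variable Pr : probability T R.

Definition independent2 (X Y : T -> R) : Prop :=
  forall A B : set R, measurable A -> measurable B ->
    Pr (X @^-1` A `&` Y @^-1` B) = (Pr (X @^-1` A) * Pr (Y @^-1` B))%E.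

(* Under independence the joint law of (X, Y) is the product of the laws, so
   that Fubini's theorem applies. *)
Lemma independent2_integralM (X Y : {mfun T >-> R}) :
  independent2 X Y ->
  Pr.-integrable setT (fun t => (X t)%:E) ->
  Pr.-integrable setT (fun t => (Y t)%:E) ->
  Pr.-integrable setT (fun t => (X t * Y t)%:E) /\
  (\int[Pr]_t (X t * Y t)%:E = \int[Pr]_t (X t)%:E * \int[Pr]_t (Y t)%:E)%E.
Proof.
move=> XY iX iY.
have mJ : measurable_fun setT (fun t => (X t, Y t)).
  by apply: measurable_fun_pair.
pose J : {mfun T >-> (R * R)%type} := HB.pack (fun t => (X t, Y t))
  (isMeasurableFun.Build _ _ _ _ (fun t => (X t, Y t)) mJ).
pose PX := distribution Pr X; pose PY := distribution Pr Y.
(* A measure that factors on rectangles is the product measure; on rectangles this is exactly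
   independence. *)
have lawE A : measurable A -> (PX \x PY)%E A = distribution Pr J A.
  apply: product_measure_unique => B C mB mC /=.
  by rewrite /distribution /pushforward -XY.
have law_int f : (\int[(PX \x PY)%E]_z f z = \int[distribution Pr J]_z f z)%E.
  by apply: eq_measure_integral => A mA _; exact: lawE.
pose f := fun z : R * R => (z.1 * z.2)%:E.
have mf : measurable_fun setT f.
  by apply/measurable_EFinP; apply: measurable_funM;
    [exact: measurable_fst|exact: measurable_snd].
have mid : measurable_fun [set: R] (fun x : R => x%:E).
  exact/measurable_EFinP.
have mabs : measurable_fun [set: R] (fun x : R => `|x%:E|%E).
  exact: measurableT_comp.
have absX : (\int[PX]_x `|x%:E| = \int[Pr]_t `|(X t)%:E|)%E.
  by rewrite ge0_integral_distribution.
have absY : (\int[PY]_x `|x%:E| = \int[Pr]_t `|(Y t)%:E|)%E.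
  by rewrite ge0_integral_distribution.
have iPX : PX.-integrable setT (fun x : R => x%:E).
  apply/integrableP; split=> //; rewrite absX.
  by case/integrableP : iX.
have iPY : PY.-integrable setT (fun x : R => x%:E).
  apply/integrableP; split=> //; rewrite absY.
  by case/integrableP : iY.
(* By Tonelli the integral of |xy| is the product of the two absolute first moments, which are
   finite. *)
have iPf : (PX \x PY)%E.-integrable setT f.
  apply/integrable12ltyP => //.
  under eq_integral => x _.
    under eq_integral => y _ do rewrite /f /= normrM EFinM.
    rewrite integralZl//; last exact: (integrable_abse iPY).
    over.
  have abs_fin : (\int[PY]_y `|y|%:E)%E \is a fin_num.
    by apply: integrable_fin_num => //; exact: (integrable_abse iPY).
  rewrite -(fineK abs_fin) integralZr//; last exact: (integrable_abse iPX).
  rewrite fineK// ltey_eq fin_numM//.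
  by apply: integrable_fin_num => //; exact: (integrable_abse iPX).
have iJ : Pr.-integrable setT (f \o J).
  apply/integrableP; split; first exact: measurableT_comp.
  have mabsf : measurable_fun setT (abse \o f) by exact: measurableT_comp.
  have absf_ge0 z : (0 <= (abse \o f) z)%E by exact: abse_ge0.
  rewrite -(ge0_integral_distribution J mabsf absf_ge0) -law_int.
  by case/integrableP : iPf.
split; first exact: iJ.
rewrite -(integral_distribution (X := J) mf iJ) -law_int.
rewrite -(integral12_prod_meas1 iPf) /fubini_F.
under eq_integral => x _.
  under eq_integral => y _ do rewrite /f /= EFinM.
  rewrite integralZl//.
  over.
have PY_fin : (\int[PY]_y y%:E)%E \is a fin_num.
  exact: integrable_fin_num.
rewrite -(fineK PY_fin) integralZr// fineK//.
by rewrite /PX /PY !integral_distribution.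
Qed.

End ProductRule.

(** * The sigma-algebra of the past and its independence from the current noise *)

Section Independence.
Context {R : realType} {d : measure_display} {T : measurableType d}.
Variables (Pr : probability T R) (w : nat -> {RV Pr >-> R}).

(** The sigma-algebra generated by this family is [filtration w k]. *)
Definition past_generators k : set (set T) :=
  \big[setU/set0]_(i < k) preimage_set_system setT (w i) measurable.

(* T with the sigma-algebra F_k, so that measurability of a function on [past k]
   is F_k-measurability. *)
Local Notation past k := (g_sigma_algebraType (past_generators k)).

(** A pi-system containing [past_generators]: closure under intersection is what uniqueness of
    measures requires. *)
Definition past_cylinders k : set (set T) :=
  [set A | exists2 E : nat -> set R, (forall j, measurable (E j)) &
    A = \bigcap_(j in [set` iota 0 k]) (w j @^-1` E j)].

Lemma past_generatorsP k A : past_generators k A <->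
  exists j E, [/\ (j < k)%N, measurable E & A = w j @^-1` E].
Proof.
rewrite /past_generators
  -(bigcup_mkord k (fun i => preimage_set_system setT (w i) measurable)).
split=> [[j /= jk [E mE <-]]|[j [E [jk mE ->]]]].
  by exists j, E; rewrite setTI.
by exists j => //; exists E => //; rewrite setTI.
Qed.

Lemma past_generators_cylinders k : past_generators k `<=` past_cylinders k.
Proof.
move=> A /past_generatorsP[j [E [jk mE ->]]].
exists (fun i => if i == j then E else setT) => [i|]; first by case: ifP.
apply/seteqP; split=> [t Et i _ /=|t /(_ j)/=]; first by case: eqP => // ->.
by rewrite eqxx mem_iota jk; apply.
Qed.

Lemma measurable_past_cylinders k : past_cylinders k `<=` measurable.
Proof.
move=> A [E mE ->]; rewrite bigcap_seq.
apply: bigsetI_measurable => i _.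
by rewrite -[_ @^-1` _]setTI; exact: measurable_funP.
Qed.

Lemma past_cylinders_setI k : setI_closed (past_cylinders k).
Proof.
move=> A B [E mE ->] [F mF ->].
exists (fun j => E j `&` F j) => [j|]; first exact: measurableI.
by rewrite -bigcapI.
Qed.

Lemma measurable_past_sub k (A : set T) :
  measurable (A : set (past k)) -> measurable A.
Proof.
apply: smallest_sub; first exact: sigma_algebra_measurable.
by move=> B /past_generators_cylinders/measurable_past_cylinders.
Qed.

Lemma measurable_past_fun k (X : T -> R) :
  measurable_fun setT (X : past k -> R) -> measurable_fun setT X.
Proof.
by move=> mX _ E mE; apply: (@measurable_past_sub k); exact: mX.
Qed.

Lemma measurable_past_widen k (X : T -> R) :
  measurable_fun setT (X : past k -> R) ->
  measurable_fun setT (X : past k.+1 -> R).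
Proof.
move=> mX _ E mE; have := mX measurableT E mE.
apply: sub_sigma_algebra2 => A /past_generatorsP[j [F [jk mF ->]]].
by apply/past_generatorsP; exists j, F; split => //; exact: ltnW.
Qed.

Lemma measurable_past_noise k :
  measurable_fun setT (w k : past k.+1 -> R).
Proof.
move=> _ E mE; rewrite setTI; apply: sub_sigma_algebra.
by apply/past_generatorsP; exists k, E; split.
Qed.

Hypothesis w_indep : mutually_independent Pr w.

(** Pi-lambda argument: for fixed [E] both sides are finite measures in [A]; mutual independence
    makes them agree on the cylinders, a pi-system whose sigma-algebra contains F_k. *)
Lemma past_noise_independent k (A : set T) (E : set R) :
  measurable (A : set (past k)) -> measurable E ->
  Pr (A `&` w k @^-1` E) = (Pr A * Pr (w k @^-1` E))%E.
Proof.
move=> mA mE.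
have mW : measurable (w k @^-1` E).
  by rewrite -[_ @^-1` _]setTI; exact: measurable_funP.
have W_fin : Pr (w k @^-1` E) \is a fin_num by exact: fin_num_measure.
have W_ge0 : 0 <= fine (Pr (w k @^-1` E)) by exact: fine_ge0.
(* Packing the probability of the noise event as a nonnegative scalar turns the right-hand side into
   the measure [mscale c Pr]. *)
pose c := NngNum W_ge0.
have H_cyl : [set X | past_cylinders k X /\ X `<=` setT] = past_cylinders k.
  by apply/seteqP; split=> [B []|B].
have cyl_rule B : past_cylinders k B ->
    mrestr Pr mW B = mscale c Pr B.
  move=> [F mF ->]; rewrite /mrestr /mscale /= fineK// muleC.
  (* [G] appends [E] as side number [k]. Independence for the indices below [k] and for those up to
     [k] then differ by the single factor of [w k]. *)
  pose G j := if (j < k)%N then F j else E.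
  have mG j : measurable (G j) by rewrite /G; case: ifP.
  have FG j : j \in iota 0 k -> F j = G j.
    by rewrite mem_iota add0n /= /G => ->.
  have -> : \bigcap_(j in [set` iota 0 k]) (w j @^-1` F j) =
            \bigcap_(j in [set` iota 0 k]) (w j @^-1` G j).
    by apply: eq_bigcapr => j /FG ->.
  have -> : E = G k by rewrite /G ltnn.
  rewrite w_indep ?iota_uniq//.
  have := @w_indep (iota 0 k.+1) G (iota_uniq _ _) (fun j _ => mG j).
  rewrite -addn1 iotaD add0n big_cat big_seq1 /= => <-.
  congr (Pr _); apply/seteqP; split=> t /=.
    move=> [tG tk] j /=; rewrite mem_cat inE => /orP[/tG//|/eqP->//].
  move=> tG; split=> [j /= jk|]; apply: tG => /=.
    by rewrite mem_cat jk.
  by rewrite mem_cat inE eqxx orbT.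
have -> : Pr (A `&` w k @^-1` E) = mrestr Pr mW A by [].
have -> : (Pr A * Pr (w k @^-1` E))%E = mscale c Pr A.
  by rewrite /mscale /= fineK// muleC.
have setT_cyl : past_cylinders k setT.
  by exists (fun=> setT) => //; apply/seteqP; split=> [t _ j _|t _].
pose m1 : {measure set T -> \bar R} := mrestr Pr mW.
pose m2 : {measure set T -> \bar R} := mscale c Pr.
apply: (@g_sigma_algebra_measure_unique_trace _ _ _ (past_cylinders k) setT
  measurableT _ _ m1 m2) => //.
- by rewrite H_cyl; exact: measurable_past_cylinders.
- by rewrite H_cyl; exact: past_cylinders_setI.
- exact: cyl_rule.
- by move=> B [/cyl_rule].
- rewrite /m1 /= /mrestr setTI.
  exact: (le_lt_trans (probability_le1 _ mW) (ltry _)).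
- rewrite H_cyl; move: mA; apply: sub_sigma_algebra2.
  exact: past_generators_cylinders.
Qed.

(** Events of [g (w k)] are events of [w k], so they are independent of F_k and the product rule
    applies. The identity and the square serve as [g] below. *)
Lemma past_noise_integralM k (X : T -> R) (g : R -> R) :
  measurable_fun setT (X : past k -> R) -> measurable_fun setT g ->
  Pr.-integrable setT (fun t => (X t)%:E) ->
  Pr.-integrable setT (fun t => (g (w k t))%:E) ->
  Pr.-integrable setT (fun t => (X t * g (w k t))%:E) /\
  (\int[Pr]_t (X t * g (w k t))%:E =
     \int[Pr]_t (X t)%:E * \int[Pr]_t (g (w k t))%:E)%E.
Proof.
move=> mX mg iX ig.
have mX' := measurable_past_fun mX.
have mgw : measurable_fun setT (g \o w k) by exact: measurableT_comp.
pose X' : {mfun T >-> R} := HB.pack X (isMeasurableFun.Build _ _ _ _ X mX').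
pose Y' : {mfun T >-> R} := HB.pack (g \o w k)
  (isMeasurableFun.Build _ _ _ _ (g \o w k) mgw).
apply: (@independent2_integralM _ _ _ Pr X' Y') => // A B mA mB /=.
rewrite comp_preimage past_noise_independent//.
  by rewrite -[X in measurable X]setTI; exact: mX.
by rewrite -[_ @^-1` _]setTI; exact: mg.
Qed.

End Independence.

(** * Energy balance *)

Section MeasurableVectors.
Context {R : realType} {d : measure_display} {T : measurableType d}.

(** Coordinatewise, as in [adapted]; taking [past k] for the domain expresses F_k-measurability. *)
Definition measurable_vec m (X : T -> 'cV[R]_m) : Prop :=
  forall i, measurable_fun setT (fun t => X t i 0).

Lemma measurable_vec_cst m (u : 'cV[R]_m) : measurable_vec (fun=> u).
Proof. by move=> i; exact: measurable_cst. Qed.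

Lemma measurable_vecD m (X Y : T -> 'cV[R]_m) :
  measurable_vec X -> measurable_vec Y -> measurable_vec (fun t => X t + Y t).
Proof.
move=> mX mY i; under eq_fun do rewrite mxE.
exact: measurable_funD.
Qed.

Lemma measurable_vecZ m (c : T -> R) (X : T -> 'cV[R]_m) :
  measurable_fun setT c -> measurable_vec X ->
  measurable_vec (fun t => c t *: X t).
Proof.
move=> mc mX i; under eq_fun do rewrite mxE.
exact: measurable_funM.
Qed.

Lemma measurable_vec_mulmx m p (A : 'M[R]_(p, m)) (X : T -> 'cV[R]_m) :
  measurable_vec X -> measurable_vec (fun t => A *m X t).
Proof.
move=> mX i; under eq_fun do rewrite mxE.
by apply: measurable_sum => j; apply: measurable_funM.
Qed.

Lemma measurable_bform m (P : 'M[R]_m) (X Y : T -> 'cV[R]_m) :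
  measurable_vec X -> measurable_vec Y ->
  measurable_fun setT (fun t => bform P (X t) (Y t)).
Proof.
move=> mX mY; under eq_fun do rewrite bformE.
apply: measurable_sum => j; apply: measurable_sum => i.
by apply: measurable_funM => //; apply: measurable_funM.
Qed.

Lemma measurable_sqr_enorm m (X : T -> 'cV[R]_m) :
  measurable_vec X -> measurable_fun setT (fun t => enorm (X t) ^+ 2).
Proof.
by move=> mX; under eq_fun do rewrite sqr_enorm_bform; exact: measurable_bform.
Qed.

Lemma measurable_enorm m (X : T -> 'cV[R]_m) :
  measurable_vec X -> measurable_fun setT (fun t => enorm (X t)).
Proof.
move=> mX.
have -> : (fun t => enorm (X t)) = Num.sqrt \o (fun t => enorm (X t) ^+ 2).
  by apply/funext => t /=; rewrite sqrtr_sqr ger0_norm ?enorm_ge0.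
apply: measurableT_comp; last exact: measurable_sqr_enorm.
by apply: continuous_measurable_fun; exact: sqrt_continuous.
Qed.

End MeasurableVectors.

(** * Integrable and square-integrable random variables and vectors *)

Section SquareIntegrable.
Context {R : realType} {d : measure_display} {T : measurableType d}.
Variable Pr : probability T R.

Local Notation L1 X := (Pr.-integrable setT (fun t => (X t)%:E)).

Definition sqr_integrable (X : T -> R) : Prop :=
  measurable_fun setT X /\ L1 (fun t => X t ^+ 2).

Definition sqr_integrable_vec m (X : T -> 'cV[R]_m) : Prop :=
  forall i, sqr_integrable (fun t => X t i 0).

Lemma L1D (X Y : T -> R) : L1 X -> L1 Y -> L1 (fun t => X t + Y t).
Proof. by move=> iX iY; exact: (integrableD measurableT iX iY). Qed.

Lemma L1Z (c : R) (X : T -> R) : L1 X -> L1 (fun t => c * X t).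
Proof. by move=> iX; exact: (integrableZl measurableT c iX). Qed.

Lemma L1_cst (c : R) : L1 (fun=> c).
Proof. exact: finite_measure_integrable_cst. Qed.

Lemma L1_sum (I : Type) (s : seq I) (X : I -> T -> R) :
  (forall i, L1 (X i)) -> L1 (fun t => \sum_(i <- s) X i t).
Proof.
move=> iX; elim: s => [|i s IH].
  by under eq_fun do rewrite big_nil; exact: L1_cst.
by under eq_fun do rewrite big_cons; exact: L1D.
Qed.

Lemma L1_le (X Y : T -> R) : measurable_fun setT X ->
  (forall t, `|X t| <= Y t) -> L1 Y -> L1 X.
Proof.
move=> mX XY; apply: le_integrable => //; first exact/measurable_EFinP.
by move=> t _ /=; rewrite lee_fin (le_trans (XY t))// ler_norm.
Qed.

Lemma ge0_L1 (X : T -> R) : measurable_fun setT X -> (forall t, 0 <= X t) ->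
  ('E_Pr[X] < +oo)%E -> L1 X.
Proof.
move=> mX X0; rewrite unlock => EX; apply/integrableP; split.
  exact/measurable_EFinP.
by under eq_integral do rewrite gee0_abs ?lee_fin//.
Qed.

Lemma meanD (X Y : T -> R) : L1 X -> L1 Y ->
  ('E_Pr[fun t => (X t + Y t)%R] = 'E_Pr[X] + 'E_Pr[Y])%E.
Proof. by move=> iX iY; apply: expectationD; exact/Lfun1_integrable. Qed.

Lemma meanZ (c : R) (X : T -> R) : L1 X ->
  ('E_Pr[fun t => (c * X t)%R] = c%:E * 'E_Pr[X])%E.
Proof.
move=> iX; rewrite -expectationZl; last exact/Lfun1_integrable.
by congr expectation; apply/funext => t /=; rewrite mulrC.
Qed.

Lemma mean_le (X Y : T -> R) : L1 X -> L1 Y -> (forall t, X t <= Y t) ->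
  ('E_Pr[X] <= 'E_Pr[Y])%E.
Proof.
move=> iX iY XY; rewrite unlock; apply: le_integral => // t _.
by rewrite lee_fin.
Qed.

(** Domination by |xy| <= x^2 + y^2. *)
Lemma sqr_integrableM (X Y : T -> R) :
  sqr_integrable X -> sqr_integrable Y -> L1 (fun t => X t * Y t).
Proof.
move=> [mX iX] [mY iY]; apply: L1_le (L1D iX iY); first exact: measurable_funM.
move=> t; rewrite normrM -[X t ^+ 2]real_normK ?num_real//.
rewrite -[Y t ^+ 2]real_normK ?num_real//.
move: (`|X t|) (`|Y t|) (normr_ge0 (X t)) (normr_ge0 (Y t)) => x y x0 y0.
nra.
Qed.

Lemma sqr_integrableD (X Y : T -> R) :
  sqr_integrable X -> sqr_integrable Y -> sqr_integrable (fun t => X t + Y t).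
Proof.
move=> sX sY; have [mX iX] := sX; have [mY iY] := sY.
split; first exact: measurable_funD.
have sqrE t : (X t + Y t) ^+ 2 = X t ^+ 2 + 2 * (X t * Y t) + Y t ^+ 2 by ring.
under eq_fun do rewrite sqrE.
by apply: L1D => //; apply: L1D => //; apply: L1Z; exact: sqr_integrableM.
Qed.

Lemma sqr_integrableZ (c : R) (X : T -> R) :
  sqr_integrable X -> sqr_integrable (fun t => c * X t).
Proof.
move=> [mX iX]; split; first exact: measurable_funM.
by under eq_fun do rewrite exprMn; exact: L1Z.
Qed.

Lemma sqr_integrable_cst (c : R) : sqr_integrable (fun=> c).
Proof. by split; [exact: measurable_cst|exact: L1_cst]. Qed.

Lemma sqr_integrable_sum (I : Type) (s : seq I) (X : I -> T -> R) :
  (forall i, sqr_integrable (X i)) ->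
  sqr_integrable (fun t => \sum_(i <- s) X i t).
Proof.
move=> iX; elim: s => [|i s IH].
  by under eq_fun do rewrite big_nil; exact: sqr_integrable_cst.
by under eq_fun do rewrite big_cons; exact: sqr_integrableD.
Qed.

Lemma sqr_integrable_vecD m (X Y : T -> 'cV[R]_m) :
  sqr_integrable_vec X -> sqr_integrable_vec Y ->
  sqr_integrable_vec (fun t => X t + Y t).
Proof.
move=> sX sY i; under eq_fun do rewrite mxE.
exact: sqr_integrableD.
Qed.

Lemma sqr_integrable_mulmx m p (A : 'M[R]_(p, m)) (X : T -> 'cV[R]_m) :
  sqr_integrable_vec X -> sqr_integrable_vec (fun t => A *m X t).
Proof.
move=> sX i; under eq_fun do rewrite mxE.
by apply: sqr_integrable_sum => j; exact: sqr_integrableZ.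
Qed.

Lemma L1_bform m (P : 'M[R]_m) (X Y : T -> 'cV[R]_m) :
  sqr_integrable_vec X -> sqr_integrable_vec Y ->
  L1 (fun t => bform P (X t) (Y t)).
Proof.
move=> sX sY; under eq_fun do rewrite bformE.
apply: L1_sum => j; apply: L1_sum => i.
under eq_fun do rewrite mulrAC mulrC.
by apply: L1Z; exact: sqr_integrableM.
Qed.

Lemma L1_sqr_enorm m (X : T -> 'cV[R]_m) :
  sqr_integrable_vec X -> L1 (fun t => enorm (X t) ^+ 2).
Proof.
by move=> sX; under eq_fun do rewrite sqr_enorm_bform; exact: L1_bform.
Qed.

Lemma sqr_enorm_sqr_integrable m (X : T -> 'cV[R]_m) :
  measurable_vec X -> L1 (fun t => enorm (X t) ^+ 2) -> sqr_integrable_vec X.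
Proof.
move=> mX iX i; split; first exact: mX.
apply: L1_le iX; first exact: measurable_funX.
by move=> t; rewrite ger0_norm ?sqr_ge0// sqr_coord_le_enorm.
Qed.

End SquareIntegrable.

(** * Mean energy along recursions driven by the noise *)

Section Energy.
Context {R : realType} {d : measure_display} {T : measurableType d}.
Variables (Pr : probability T R) (w : nat -> {RV Pr >-> R}).
Hypothesis w_indep : mutually_independent Pr w.
Hypothesis w_mean : forall k, ('E_Pr[w k] = 0)%E.
Hypothesis w_var : forall k, ('E_Pr[fun t => (w k t ^+ 2)%R] = 1)%E.

Local Notation L1 X := (Pr.-integrable setT (fun t => (X t)%:E)).
Local Notation past k := (g_sigma_algebraType (past_generators w k)).

Lemma noise_sqr_integrable k : sqr_integrable Pr (w k).
Proof.
split=> //; apply: ge0_L1 => //.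
- exact: measurable_funX.
- by move=> t; exact: sqr_ge0.
- by rewrite w_var ltry.
Qed.

Lemma noise_L1 k : L1 (w k).
Proof.
have := sqr_integrableM (noise_sqr_integrable k) (sqr_integrable_cst Pr 1).
by under eq_fun do rewrite mulr1.
Qed.

(** This removes the cross term when the square of drift plus noise times diffusion is expanded: [X]
    is known before [w k] is drawn, and [w k] is centred. *)
Lemma mean_noise_cross k (X : T -> R) :
  measurable_fun setT (X : past k -> R) -> L1 X ->
  L1 (fun t => X t * w k t) /\ ('E_Pr[fun t => (X t * w k t)%R] = 0)%E.
Proof.
move=> mX iX.
have [|iXw EXw] := past_noise_integralM w_indep mX (g := id)
  (@measurable_id _ _ _) iX.
  exact: noise_L1.
split=> //; rewrite unlock [LHS]EXw.
by have := w_mean k; rewrite unlock => ->; rewrite mule0.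
Qed.

(** The unit variance factors out by independence, leaving the diffusion energy unchanged in
    mean. *)
Lemma mean_noise_sqr k (X : T -> R) :
  measurable_fun setT (X : past k -> R) -> L1 X ->
  L1 (fun t => X t * w k t ^+ 2) /\
  ('E_Pr[fun t => (X t * w k t ^+ 2)%R] = 'E_Pr[X])%E.
Proof.
move=> mX iX.
have [|iXw EXw] := past_noise_integralM w_indep mX (g := fun x => x ^+ 2)
  (measurable_funX 2 (@measurable_id _ _ _)) iX.
  by have [] := noise_sqr_integrable k.
split=> //; rewrite unlock [LHS]EXw.
by have := w_var k; rewrite unlock => ->; rewrite mule1.
Qed.

(** A product of two square-integrable variables is in general only integrable; here its square is
    integrable because [b] is F_k-measurable, hence independent of [w k]. *)
Lemma noise_step_sqr_integrable k m (a b : T -> 'cV[R]_m) :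
  measurable_vec (b : past k -> _) ->
  sqr_integrable_vec Pr a -> sqr_integrable_vec Pr b ->
  sqr_integrable_vec Pr (fun t => a t + w k t *: b t).
Proof.
move=> mb sa sb i; under eq_fun do rewrite !mxE.
apply: sqr_integrableD => //; split.
  by apply: measurable_funM => //; have [] := sb i.
under eq_fun do rewrite exprMn mulrC.
apply: (proj1 (mean_noise_sqr _ _)); last by have [] := sb i.
exact: measurable_funX.
Qed.

Lemma mean_noise_step k m (P : 'M[R]_m) (a b : T -> 'cV[R]_m) : P^T = P ->
  measurable_vec (a : past k -> _) -> measurable_vec (b : past k -> _) ->
  sqr_integrable_vec Pr a -> sqr_integrable_vec Pr b ->
  ('E_Pr[fun t => (bform P (a t + w k t *: b t) (a t + w k t *: b t))%R] =
  'E_Pr[fun t => bform P (a t) (a t)] + 'E_Pr[fun t => bform P (b t) (b t)])%E.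
Proof.
move=> Ps ma mb sa sb.
under [X in expectation _ X]eq_fun do rewrite bform_combination//.
have [iab Eab] := mean_noise_cross (measurable_bform P ma mb)
  (L1_bform P sa sb).
have [ibb Ebb] := mean_noise_sqr (measurable_bform P mb mb)
  (L1_bform P sb sb).
have iaa := L1_bform P sa sa.
rewrite meanD//; last by apply: L1D => //; exact: L1Z.
by rewrite meanD ?meanZ ?Eab ?mule0 ?adde0 ?Ebb//; exact: L1Z.
Qed.

Section Recursion.
Variables (m : nat) (X a b : nat -> T -> 'cV[R]_m) (x0 : 'cV[R]_m).
Hypothesis X0 : X 0%N = fun=> x0.
Hypothesis XS : forall k, X k.+1 = fun t => a k t + w k t *: b k t.
Hypothesis ma : forall k, measurable_vec (X k : past k -> _) ->
  measurable_vec (a k : past k -> _).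
Hypothesis mb : forall k, measurable_vec (X k : past k -> _) ->
  measurable_vec (b k : past k -> _).
Hypothesis sa : forall k, sqr_integrable_vec Pr (X k) ->
  sqr_integrable_vec Pr (a k).
Hypothesis sb : forall k, sqr_integrable_vec Pr (X k) ->
  sqr_integrable_vec Pr (b k).

(** [X k.+1] involves [w k], which is measurable only from F_(k+1) on; drift and diffusion are
    F_k-measurable and are widened to match. *)
Lemma recursion_measurable k : measurable_vec (X k : past k -> _).
Proof.
elim: k => [|k IH]; first by rewrite X0; exact: measurable_vec_cst.
rewrite XS; apply: measurable_vecD.
  by move=> i; apply: measurable_past_widen; exact: ma.
apply: measurable_vecZ; first exact: measurable_past_noise.
by move=> i; apply: measurable_past_widen; exact: mb.
Qed.

Lemma recursion_sqr_integrable k : sqr_integrable_vec Pr (X k).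
Proof.
elim: k => [|k IH]; first by rewrite X0 => i; exact: sqr_integrable_cst.
rewrite XS; apply: noise_step_sqr_integrable; [|exact: sa|exact: sb].
by apply: mb; exact: recursion_measurable.
Qed.

(** Here [r] is the energy extracted and [s] the energy supplied. Taking means in the dissipation
    inequality gives a one-step balance for the stored energy [V], which telescopes. *)
Lemma energy_balance (P : 'M[R]_m) (r s : nat -> T -> R) N : posdef P ->
  (forall k, L1 (r k)) -> (forall k, L1 (s k)) ->
  (forall k t, bform P (a k t) (a k t) + bform P (b k t) (b k t) + r k t <=
               bform P (X k t) (X k t) + s k t) ->
  (\sum_(0 <= k < N) 'E_Pr[r k] <=
   (bform P x0 x0)%:E + \sum_(0 <= k < N) 'E_Pr[s k])%E.
Proof.
move=> Ppos ir is_ dissipation.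
pose V k t := bform P (X k t) (X k t).
have iV k : L1 (V k) by apply: L1_bform; exact: recursion_sqr_integrable.
have step k : ('E_Pr[V k.+1] + 'E_Pr[r k] <= 'E_Pr[V k] + 'E_Pr[s k])%E.
  have mk := @recursion_measurable k; have sk := @recursion_sqr_integrable k.
  have iaa := L1_bform P (sa sk) (sa sk).
  have ibb := L1_bform P (sb sk) (sb sk).
  rewrite /V XS mean_noise_step//;
    [|by case: Ppos|exact: ma|exact: mb|exact: sa|exact: sb].
  rewrite -meanD// -meanD//; last exact: L1D.
  rewrite -meanD//; last exact: iV.
  apply: mean_le => //; first by apply: L1D => //; exact: L1D.
  by apply: L1D => //; exact: iV.
(* The final stored energy is kept on the left for the induction, then dropped because it is
   nonnegative. *)
suff : ('E_Pr[V N] + \sum_(0 <= k < N) 'E_Pr[r k] <=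
        'E_Pr[V 0%N] + \sum_(0 <= k < N) 'E_Pr[s k])%E.
  rewrite [X in (_ <= X + _)%E](_ : _ = (bform P x0 x0)%:E); last first.
    by rewrite /V X0; exact: expectation_cst.
  apply: le_trans; rewrite leeDr// expectation_ge0// => t.
  exact: posdef_ge0.
elim: N => [|N IH]; first by rewrite !big_nil.
rewrite !big_nat_recr//= addeC -addeA [X in (_ + X <= _)%E]addeC.
apply: (@le_trans _ _
  (\sum_(0 <= k < N) 'E_Pr[r k] + ('E_Pr[V N] + 'E_Pr[s N]))%E).
  by rewrite leeD2l.
by rewrite addeA [leRHS]addeA leeD2r// addeC.
Qed.

(** Tonelli exchanges series and mean; each partial sum of [r] is bounded using the whole series of
    [s], and the bound passes to the limit. *)
Lemma series_energy_balance (P : 'M[R]_m) (r s : nat -> T -> R) : posdef P ->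
  (forall k, L1 (r k)) -> (forall k, L1 (s k)) ->
  (forall k t, 0 <= r k t) -> (forall k t, 0 <= s k t) ->
  (forall k t, bform P (a k t) (a k t) + bform P (b k t) (b k t) + r k t <=
               bform P (X k t) (X k t) + s k t) ->
  (\int[Pr]_t \sum_(0 <= k <oo) (r k t)%:E <=
   (bform P x0 x0)%:E + \int[Pr]_t \sum_(0 <= k <oo) (s k t)%:E)%E.
Proof.
move=> Ppos ir is_ r0 s0 dissipation.
have series_mean (q : nat -> T -> R) : (forall k, L1 (q k)) ->
    (forall k t, 0 <= q k t) ->
    (\int[Pr]_t \sum_(0 <= k <oo) (q k t)%:E = \sum_(0 <= k <oo) 'E_Pr[q k])%E.
  move=> iq q0; rewrite integral_nneseries//.
  - by apply: eq_eseriesr => k _; rewrite unlock.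
  - by move=> k; exact: (measurable_int Pr (iq k)).
  - by move=> k t _; rewrite lee_fin.
rewrite !series_mean//; apply: lime_le.
  by apply: is_cvg_nneseries => k _ _; exact: expectation_ge0.
apply: nearW => N; apply: (le_trans (energy_balance N Ppos ir is_ dissipation)).
rewrite leeD2l//; apply: nneseries_lim_ge => k _ _; exact: expectation_ge0.
Qed.

End Recursion.
End Energy.

(** * Stability *)

Section Stability.
Context {R : realType} {d : measure_display} {T : measurableType d}.
Variables (Pr : probability T R) (w : nat -> {RV Pr >-> R}).
Hypothesis w_indep : mutually_independent Pr w.
Hypothesis w_mean : forall k, ('E_Pr[w k] = 0)%E.
Hypothesis w_var : forall k, ('E_Pr[fun t => (w k t ^+ 2)%R] = 1)%E.
Context {n nv ny nz : nat}.
Variables (S : plant R n nv ny nz) (gamma : R).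

Local Notation L1 X := (Pr.-integrable setT (fun t => (X t)%:E)).
Local Notation past k := (g_sigma_algebraType (past_generators w k)).

Section Trajectories.
Variables (Khat : 'M[R]_(n, ny)) (v : nat -> T -> 'cV[R]_nv).
Variable eta0 : 'cV[R]_(n + n).
Hypothesis mv : forall k, measurable_vec (v k : past k -> _).
Hypothesis sv : forall k, sqr_integrable_vec Pr (v k).
Let eta := aug_state S w v Khat eta0.

Lemma aug_state_measurable k : measurable_vec (eta k : past k -> _).
Proof.
apply: (@recursion_measurable _ _ _ _ _ _ eta
  (fun k t => augA S Khat *m eta k t + augB S Khat *m v k t)
  (fun k t => augC S *m eta k t + augD S *m v k t) eta0) => // j mj;
  by apply: measurable_vecD; exact: measurable_vec_mulmx.
Qed.

Lemma aug_state_sqr_integrable k : sqr_integrable_vec Pr (eta k).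
Proof.
apply: (@recursion_sqr_integrable _ _ _ _ _ w_indep w_var _ eta
  (fun k t => augA S Khat *m eta k t + augB S Khat *m v k t)
  (fun k t => augC S *m eta k t + augD S *m v k t) eta0) => // j mj.
1,2: by apply: measurable_vecD; exact: measurable_vec_mulmx.
1,2: by apply: sqr_integrable_vecD; exact: sqr_integrable_mulmx.
Qed.

Lemma aug_output_sqr_integrable k :
  sqr_integrable_vec Pr (aug_output S w v Khat eta0 k).
Proof.
apply: sqr_integrable_vecD; apply: sqr_integrable_mulmx => //.
exact: aug_state_sqr_integrable.
Qed.

Lemma aug_energy_balance (P : 'M[R]_(n + n)) (r s : nat -> T -> R) : posdef P ->
  (forall k, L1 (r k)) -> (forall k, L1 (s k)) ->
  (forall k t, 0 <= r k t) -> (forall k t, 0 <= s k t) ->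
  (forall k t,
    let drift := augA S Khat *m eta k t + augB S Khat *m v k t in
    let diffusion := augC S *m eta k t + augD S *m v k t in
    bform P drift drift + bform P diffusion diffusion + r k t <=
    bform P (eta k t) (eta k t) + s k t) ->
  (\int[Pr]_t \sum_(0 <= k <oo) (r k t)%:E <=
   (bform P eta0 eta0)%:E + \int[Pr]_t \sum_(0 <= k <oo) (s k t)%:E)%E.
Proof.
move=> Ppos ir is_ r0 s0 dissipation.
apply: (@series_energy_balance _ _ _ _ _ w_indep w_mean w_var _ eta
  (fun k t => augA S Khat *m eta k t + augB S Khat *m v k t)
  (fun k t => augC S *m eta k t + augD S *m v k t) eta0) => // j mj.
1,2: by apply: measurable_vecD; exact: measurable_vec_mulmx.
1,2: by apply: sqr_integrable_vecD; exact: sqr_integrable_mulmx.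
Qed.

End Trajectories.

(** * External and internal stability from a feasible LMI *)

Variables (P1 P2 : 'M[R]_n) (PK : 'M[R]_(n, ny)).
Hypothesis lmi : lmi_feasible S gamma P1 P2 PK.
Let Khat := invmx P2 *m PK.

(** Energy balance for the storage matrix diag([P1], [P2]), with output energy extracted and
    [gamma ^+ 2] times input energy supplied; the initial state 0 stores nothing. *)
Lemma lmi_externally_stable : externally_stable Pr S w gamma Khat.
Proof.
move=> v [v_adapted v_fin] _.
have mv k : measurable_vec (v k : past k -> _).
  by move=> i _ E mE; rewrite setTI; exact: v_adapted.
have mvT k : measurable_vec (v k).
  by move=> i; exact: measurable_past_fun (mv k i).
have mvE k : measurable_fun setT (fun t => (enorm (v k t) ^+ 2)%:E).
  by apply/measurable_EFinP; exact: measurable_sqr_enorm.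
(* Each single term has mean energy at most the finite norm of the whole sequence. *)
have sv k : sqr_integrable_vec Pr (v k).
  apply: sqr_enorm_sqr_integrable => //.
  apply: ge0_L1; [exact: measurable_sqr_enorm|by move=> t; exact: sqr_ge0|].
  apply: le_lt_trans v_fin; rewrite unlock; apply: ge0_le_integral => //.
  - by move=> t _; rewrite lee_fin sqr_ge0.
  - by apply: ge0_emeasurable_sum => // j t _; rewrite lee_fin sqr_ge0.
  (* The partial sum of length [k.+1] is the first to contain the term of index [k]. *)
  - move=> t _; have := @nneseries_lim_ge R (fun j => (enorm (v j t) ^+ 2)%:E)
      xpredT 0%N k.+1.
    move=> /(_ (fun j _ _ => _)) le_series.
    apply: (le_trans _ (le_series _)) => [|j]; last by rewrite lee_fin sqr_ge0.
    rewrite big_nat_recr//= leeDr// sume_ge0// => j _.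
    by rewrite lee_fin sqr_ge0.
have := @aug_energy_balance Khat v 0 mv sv (block_mx P1 0 0 P2)
  (fun k t => enorm (aug_output S w v Khat 0 k t) ^+ 2)
  (fun k t => gamma ^+ 2 * enorm (v k t) ^+ 2).
rewrite bform0r add0e => balance.
apply: (le_trans (balance _ _ _ _ _ _)).
- by case: lmi => *; exact: posdef_block_diag.
- by move=> k; apply: L1_sqr_enorm; exact: aug_output_sqr_integrable.
- by move=> k; apply: L1Z; exact: L1_sqr_enorm.
- by move=> k t; exact: sqr_ge0.
- by move=> k t; rewrite mulr_ge0 ?sqr_ge0.
- by move=> k t; exact: lmi_dissipation_le.
rewrite /l2_norm_sq -ge0_integralZl_EFin//.
- rewrite le_eqVlt; apply/orP; left; apply/eqP; apply: eq_integral => t _.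
  rewrite -nneseriesZl; last by move=> k _; rewrite lee_fin sqr_ge0.
  by apply: eq_eseriesr => k _; rewrite EFinM.
- by move=> t _; apply: nneseries_ge0 => k _ _; rewrite lee_fin sqr_ge0.
- by apply: ge0_emeasurable_sum => // j t _; rewrite lee_fin sqr_ge0.
- exact: sqr_ge0.
Qed.

Hypothesis Pr_complete : measure_is_complete Pr.

Lemma lmi_internally_stable : internally_stable Pr S w Khat.
Proof.
have [Q Qpos lyapunov] := lmi_lyapunov lmi.
rewrite /internally_stable; set eta := aug_state _ _ _ _.
have mv k : measurable_vec ((fun _ _ => 0 : 'cV[R]_nv) k : past k -> _).
  exact: measurable_vec_cst.
have sv k : sqr_integrable_vec Pr ((fun (_ : nat) (_ : T) => 0 : 'cV[R]_nv) k).
  by move=> i; exact: sqr_integrable_cst.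
(* The total energy of a trajectory: it dominates every term, and its mean is bounded by the
   Lyapunov form at [eta0]. *)
pose Z eta0 t := (\sum_(0 <= k <oo) (enorm (eta eta0 k t) ^+ 2)%:E)%E.
have meta eta0 k : measurable_vec (eta eta0 k).
  by move=> i; exact: measurable_past_fun (aug_state_measurable Khat eta0 mv i).
have metaE eta0 k :
    measurable_fun setT (fun t => (enorm (eta eta0 k t) ^+ 2)%:E).
  by apply/measurable_EFinP; exact: measurable_sqr_enorm.
have mZ eta0 : measurable_fun setT (Z eta0).
  by apply: ge0_emeasurable_sum => // j t _; rewrite lee_fin sqr_ge0.
have Z_ge0 eta0 t : (0 <= Z eta0 t)%E.
  by apply: nneseries_ge0 => k _ _; rewrite lee_fin sqr_ge0.
have term_le_Z eta0 k t : ((enorm (eta eta0 k t) ^+ 2)%:E <= Z eta0 t)%E.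
  apply: (le_trans _ (nneseries_lim_ge k.+1 _)) => [|j _ _]; last first.
    by rewrite lee_fin sqr_ge0.
  rewrite big_nat_recr//= leeDr// sume_ge0// => j _.
  by rewrite lee_fin sqr_ge0.
have intZ eta0 : (\int[Pr]_t Z eta0 t <= (bform Q eta0 eta0)%:E)%E.
  have := @aug_energy_balance Khat (fun _ _ => 0) eta0 mv sv Q
    (fun k t => enorm (eta eta0 k t) ^+ 2) (fun _ _ => 0) Qpos.
  under [X in (_ <= _ + X)%E]eq_integral do rewrite eseries0//.
  rewrite integral0 adde0; apply => //.
  - by move=> k; apply: L1_sqr_enorm; exact: aug_state_sqr_integrable.
  - by move=> k; exact: L1_cst.
  - by move=> k t; exact: sqr_ge0.
  - by move=> k t /=; rewrite !mulmx0 !addr0.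
split=> [eps eps0|eta0].
  pose B eta0 := [set t | (eps%:E < ereal_sup (range (fun k =>
                             (enorm (eta eta0 k t))%:E)))%E].
  (* The supremum exceeds [eps] exactly when some term does, so the event is a countable union. *)
  have mB eta0 : measurable (B eta0).
    have -> : B eta0 = \bigcup_k
        ((fun t => enorm (eta eta0 k t)) @^-1` `]eps, +oo[).
      apply/seteqP; split=> [t /ereal_sup_gt[_ [k _ <-]]|t [k _]] /=.
        by rewrite lte_fin => epsk; exists k => //=; rewrite in_itv /= andbT.
      rewrite in_itv /= andbT => epsk.
      apply: (@lt_le_trans _ _ (enorm (eta eta0 k t))%:E).
        by rewrite lte_fin.
      by apply: ereal_sup_ubound; exists k.
    apply: bigcupT_measurable => k; rewrite -[_ @^-1` _]setTI.
    exact: measurable_enorm.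
  (* Markov's inequality: on [B eta0] some term already forces [eps ^+ 2 <= Z]. *)
  have PrB eta0 : (Pr (B eta0) <= (bform Q eta0 eta0 / eps ^+ 2)%:E)%E.
    rewrite EFinM lee_pdivlMr ?exprn_gt0//; apply: le_trans (intZ eta0).
    rewrite muleC -integral_cst//.
    apply: (@le_trans _ _ (\int[Pr]_(t in B eta0) Z eta0 t)%E).
      apply: ge0_le_integral => //.
      - by move=> t _; rewrite lee_fin sqr_ge0.
      - exact: measurable_funTS.
      - move=> t /ereal_sup_gt[_ [k _ <-]]; rewrite lte_fin => epsk.
        apply: le_trans (term_le_Z eta0 k t).
        by rewrite lee_fin ler_sqr ?nnegrE ?enorm_ge0 ?ltW.
    exact: ge0_subset_integral.
  (* The upper bound is continuous in [eta0] and vanishes at 0. *)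
  apply: (@squeeze_cvge _ _ _ _ (cst 0%E) _
    (fun eta0 => (bform Q eta0 eta0 / eps ^+ 2)%:E)).
  - by apply: nearW => eta0; rewrite measure_ge0 PrB.
  - exact: cvg_cst.
  - apply: cvg_EFin; first exact: nearW.
    rewrite -[X in _ --> X](_ : bform Q 0 0 / eps ^+ 2 = 0); last first.
      by rewrite bform0r mul0r.
    apply: cvgM; last exact: cvg_cst.
    apply: cvg_within_filter; exact: continuous_bform.
set A := [set t | _].
have Zae : {ae Pr, forall t, setT t -> Z eta0 t \is a fin_num}.
  apply: integrable_ae => //; apply/integrableP; split => //.
  under eq_integral do rewrite gee0_abs//.
  exact: le_lt_trans (intZ eta0) (ltry _).
(* Where [Z] is finite, the terms of a convergent series tend to 0, so divergent trajectories lie in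
   a null set. *)
have CA_null : Pr.-negligible (~` A).
  apply: negligibleS Zae => t /= CAt Zt; apply: CAt.
  apply: sqr_enorm_cvg0; apply: cvg_series_cvg_0.
  apply: nnseries_is_cvg => [k|]; first exact: sqr_ge0.
  by rewrite ltey_eq Zt.
(* Completeness of the probability turns the negligible complement into a measurable set. *)
have mCA : measurable (~` A) by exact: Pr_complete.
have mA : measurable A by rewrite -[A]setCK; exact: measurableC.
have := probability_setC Pr mCA; rewrite setCK => ->.
by rewrite (measure_negligible mCA CA_null) sube0.
Qed.

End Stability.

Theorem theorem4 (R : realType) (d : measure_display) (T : measurableType d)
    (Pr : probability T R) (w : nat -> {RV Pr >-> R})
    (n nv ny nz : nat) (S : plant R n nv ny nz) (gamma : R)
    (Pr_complete : measure_is_complete Pr)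
    (w_indep : mutually_independent Pr w)
    (w_mean : forall k, ('E_Pr[w k] = 0)%E)
    (w_var : forall k, ('E_Pr[fun t => (w k t ^+ 2)%R] = 1)%E)
    (gamma_gt0 : 0 < gamma) :
  (forall (P1 P2 : 'M[R]_n) (PK : 'M[R]_(n, ny)),
     lmi_feasible S gamma P1 P2 PK ->
     Hinf_filter Pr S w gamma (invmx P2 *m PK)) /\
  (forall (eps : R) (P1 P2 : 'M[R]_n) (PK : 'M[R]_(n, ny)), 0 <= eps ->
     mixed_solution S gamma eps P1 P2 PK ->
     Hinf_filter Pr S w gamma (invmx P2 *m PK)).
Proof.
have Hinf P1 P2 PK : lmi_feasible S gamma P1 P2 PK ->
    Hinf_filter Pr S w gamma (invmx P2 *m PK).
  move=> lmi; split.
    exact: (lmi_internally_stable w_indep w_mean w_var lmi Pr_complete).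
  exact: (lmi_externally_stable w_indep w_mean w_var lmi).
(* A minimizer, exact or up to [eps], is in particular feasible, so the second claim reduces to the
   first. *)
split=> [P1 P2 PK lmi|eps P1 P2 PK _ [lmi _]]; exact (Hinf _ _ _ lmi).
Qed.
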